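(* There exists a universal constant $C>0$ (independent of $p$, $n$ and the random vector) such that the following holds. Let $p\ge 2$ and let $X=(X_1,\dots,X_n)$ be a random vector in $\mathbb{R}^n$ with independent $p$-sub-exponential coordinates $X_i$ that satisfy $\mathbb{E}|X_1|^p=\mathbb{E}|X_i|^p$ for $i=2,3,\dots,n$. Then $$ \big\|\,|X|_p-n^{1/p}\|X_1\|_{L^p}\,\big\|_{\psi_p}\le 6^{1/p}\,C\,\Big(\frac{K_p}{\|X_1\|_{L^p}}\Big)^{p-1}K_p, $$ where $K_p:=\max_{1\le i\le n}\|X_i\|_{\psi_p}$.
   Context: For $p>0$, a real random variable $Y$ is called $p$-sub-exponential if there exist constants $c,C'>0$ such that $\mathbb{P}(|Y|\ge t)\le c\exp(-(t/C')^p)$ for all $t\ge 0$; equivalently, $\|Y\|_{\psi_p}<\infty$, where $$\|Y\|_{\psi_p}:=\inf\{K>0:\ \mathbb{E}\exp(|Y/K|^p)\le 2\},\qquad \inf\emptyset=\infty.$$ For $x\in\mathbb{R}^n$ and $p\ge1$, $|x|_p=(\sum_{i=1}^n|x_i|^p)^{1/p}$. For a random variable $Y$, $\|Y\|_{L^p}=(\mathbb{E}|Y|^p)^{1/p}$. *)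

(* Defs.v *)
From HB Require Import structures.
From mathcomp Require Import all_boot all_order all_algebra.
From mathcomp Require Import all_classical all_reals all_analysis.

Set Implicit Arguments.
Unset Strict Implicit.
Unset Printing Implicit Defensive.

Import Order.TTheory GRing.Theory Num.Theory.

Local Open Scope classical_set_scope.
Local Open Scope ring_scope.

(* Mutual independence of a finite family of random variables; the product
   rule for subfamilies is the case where some of the [B i] are [setT]. *)
Definition independent_RVs d (T : measurableType d) (R : realType)
    (P : probability T R) (I : finType) (X : I -> {RV P >-> R}) : Prop :=
  forall B : I -> set R, (forall i, measurable (B i)) ->
    P (\bigcap_(i in [set: I]) (X i @^-1` B i)) =
    (\prod_(i : I) P (X i @^-1` B i))%E.

Definition sub_exponential d (T : measurableType d) (R : realType)
    (P : probability T R) (p : R) (Y : T -> R) : Prop :=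
  exists c C' : R, [/\ 0 < c, 0 < C' &
    forall t : R, 0 <= t ->
      (P [set w | (t <= `|Y w|)%R] <= (c * expR (- ((t / C') `^ p)))%:E)%E].

(* Extended-real valued, since [ereal_inf set0 = +oo]. *)
Definition psi_norm d (T : measurableType d) (R : realType)
    (P : probability T R) (p : R) (Y : T -> R) : \bar R :=
  ereal_inf [set K%:E | K in
    [set K : R | 0 < K /\
      ('E_P[fun w => (expR (`|Y w / K| `^ p))%R] <= 2%:E)%E]].

Definition lp_norm (R : realType) (n : nat) (p : R) (x : 'I_n -> R) : R :=
  (\sum_(i < n) `|x i| `^ p) `^ p^-1.

(* ['N[P]_q [f]] takes an extended-real valued [f]. The value [fine] drops is
   [+oo], which a [p]-sub-exponential [Y] cannot take. *)
Definition Lp_norm d (T : measurableType d) (R : realType)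
    (P : probability T R) (p : R) (Y : T -> R) : R :=
  fine ('N[P]_(p%:E) [EFin \o Y])%E.

(* Likewise finite when every [X i] is [p]-sub-exponential. *)
Definition max_psi_norm d (T : measurableType d) (R : realType)
    (P : probability T R) (n : nat) (p : R) (X : 'I_n -> {RV P >-> R}) : R :=
  fine (\big[maxe/-oo%E]_(i < n) psi_norm P p (X i)).

(* Main.v *)
(* Let Z = |X|_p, mu = n^(1/p) L with L = ||X_1||_p, and D = |Z^p - mu^p|, the
   modulus of a centred sum of independent variables. Since |a - b|^q <= |a^q - b^q| for
   q >= 1, one has |Z - mu|^p <= D, and also |Z - mu|^p mu^p <= D^2 because
   |Z - mu| mu <= |Z^2 - mu^2| and p / 2 >= 1. After dividing by K^p, the
   variable D becomes G = |sum_i (y_i - m)| with E exp(y_i) <= 2, so that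
   |Z - mu|^p is at most K^p (K / L)^p min(G^2 / n, G). Bernstein's bound
   E exp(l sum_i (y_i - m)) <= exp(C n l^2) for |l| <= 1/2 makes
   exp(c min(G^2 / n, G)) integrable with a universal bound, and convexity of
   exp lowers that bound to 2 at the price of a constant factor. Finally L <= K,
   hence K / L <= (K / L)^(p - 1). *)
Require Import Defs.
From HB Require Import structures.
From mathcomp Require Import all_boot all_order all_algebra finmap.
From mathcomp Require Import all_classical all_reals all_analysis.
From mathcomp Require Import measurable_realfun ring lra.

Set Implicit Arguments.
Unset Strict Implicit.
Unset Printing Implicit Defensive.

Import Order.TTheory GRing.Theory Num.Theory.

Local Open Scope classical_set_scope.
Local Open Scope ring_scope.

(** * Elementary inequalities for real powers *)

(** A share [t] in [(0, 1]] satisfies [t ^ q <= t] when [q >= 1]; this is applied to the shares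
    [x / (x + y)] and [y / (x + y)], which add up to 1. *)
Lemma powR_superadditive (R : realType) (q x y : R) :
  1 <= q -> 0 <= x -> 0 <= y -> x `^ q + y `^ q <= (x + y) `^ q.
Proof.
move=> q1 x0 y0; have [s0|s0] := leP (x + y) 0.
  have -> : x = 0 by lra.
  have -> : y = 0 by lra.
  by rewrite addr0 powR0 ?addr0//; lra.
have frac z : 0 <= z -> z <= x + y -> z `^ q <= z / (x + y) * (x + y) `^ q.
  move=> z0 zs; have [->|zn0] := eqVneq z 0.
    by rewrite powR0 ?mul0r//; lra.
  have -> : z `^ q = (z / (x + y) * (x + y)) `^ q by rewrite divfK ?gt_eqF.
  apply: ge1r_powRZ => //; last exact: ltW.
  rewrite ler_pdivrMr// mul1r zs andbT divr_gt0//.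
  by rewrite lt_neqAle eq_sym zn0.
have -> : (x + y) `^ q =
    x / (x + y) * (x + y) `^ q + y / (x + y) * (x + y) `^ q.
  by rewrite -mulrDl -mulrDl divff ?gt_eqF// mul1r.
by apply: lerD; apply: frac => //; lra.
Qed.

Lemma powR_dist_le (R : realType) (q a b : R) :
  1 <= q -> 0 <= a -> 0 <= b -> `|a - b| `^ q <= `|a `^ q - b `^ q|.
Proof.
move=> q1; wlog ab : a b / b <= a.
  move=> H a0 b0; have [ba|/ltW ab] := leP b a; first exact: H.
  by rewrite (distrC a b) (distrC (a `^ q)); exact: H.
move=> a0 b0.
rewrite ger0_norm ?subr_ge0// (le_trans _ (ler_norm _))// lerBrDr.
by rewrite -[in leRHS](subrK b a) powR_superadditive// subr_ge0.
Qed.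

(** The quadratic bound is the sharper one for small deviations, the linear one for large
    deviations; together they produce the minimum in the Bernstein exponent. *)
Lemma dist_powR_le_sqr (R : realType) (p z mu : R) :
  2 <= p -> 0 <= z -> 0 <= mu ->
  `|z - mu| `^ p <= `|z `^ p - mu `^ p| /\
  `|z - mu| `^ p * mu `^ p <= `|z `^ p - mu `^ p| ^+ 2.
Proof.
move=> p2 z0 mu0; split; first by apply: powR_dist_le => //; lra.
have halfK x : 0 <= x -> (x ^+ 2) `^ (p / 2) = x `^ p.
  move=> x0; rewrite -powR_mulrn// -powRrM; congr powR; lra.
have sqrK x : (x `^ (p / 2)) ^+ 2 = x `^ p.
  by rewrite -powR_mulrn ?powR_ge0// -powRrM; congr powR; lra.
(* [|z - mu| * mu <= |z ^+ 2 - mu ^+ 2|], raised to the power [p / 2 >= 1]. *)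
rewrite -powRM// -sqrK lerXn2r ?nnegrE ?powR_ge0//.
rewrite -(halfK z)// -(halfK mu)//.
apply: le_trans (powR_dist_le _ _ _); rewrite ?sqr_ge0//; last by lra.
rewrite ge0_ler_powR ?nnegrE ?mulr_ge0//; first by lra.
rewrite subr_sqr normrM ler_wpM2l// ger0_norm; lra.
Qed.

(** * Elementary inequalities for the exponential *)

(** For [u >= -1], multiply [expR u * (1 - u) <= 1] by [1 + u]. For [u < -1], the left side is at
    most 1 and [u + u ^ 2 >= 0]. *)
Lemma expR_le_quad (R : realType) (u : R) :
  expR u <= 1 + u + u ^+ 2 * expR `|u|.
Proof.
have := expR_ge1Dx (- u); rewrite expRN => eN.
have [u1|u1] := leP (-1) u.
  have eu := expR_gt0 u.
  have e1 : expR u * (1 - u) <= 1.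
    by rewrite -[leRHS](mulfV (lt0r_neq0 eu)) ler_pM2l.
  have e2 : expR u <= expR `|u| by rewrite ler_expR ler_norm.
  have e3 : expR u * (1 - u) * (1 + u) <= 1 + u.
    by rewrite -[leRHS]mul1r ler_wpM2r//; lra.
  suff : u ^+ 2 * expR u <= u ^+ 2 * expR `|u| by lra.
  by rewrite ler_wpM2l ?sqr_ge0.
have e1 : expR u <= 1 by rewrite expR_le1; lra.
have : u ^+ 2 * 1 <= u ^+ 2 * expR `|u|.
  by rewrite ler_wpM2l ?sqr_ge0// -(@expR0 R) ler_expR.
have : 0 <= (- u - 1) * (- u) by apply: mulr_ge0; lra.
lra.
Qed.

(** The linear term is kept exact so that it vanishes in expectation for centred [x]. In the
    remainder, half of the exponent of [expR |x|] absorbs [x ^ 2] and the other half absorbs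
    [expR |l * x|]. *)
Lemma expR_centered_le (R : realType) (l x : R) :
  `|l| <= 2^-1 -> expR (l * x) <= 1 + l * x + 16 * l ^+ 2 * expR `|x|.
Proof.
move=> l2; apply: le_trans (expR_le_quad _) _; rewrite lerD2l.
have x2 : x ^+ 2 <= 16 * expR (`|x| / 2).
  have h : `|x| / 4 <= expR (`|x| / 4).
    by apply: le_trans (expR_ge1Dx _); rewrite lerDr.
  have -> : expR (`|x| / 2) = expR (`|x| / 4) ^+ 2.
    by rewrite -expRM_natl; congr expR; lra.
  have : (`|x| / 4) ^+ 2 <= expR (`|x| / 4) ^+ 2.
    by rewrite lerXn2r ?nnegrE ?divr_ge0// ?expR_ge0.
  by rewrite -(real_normK (num_real x)); lra.
have e2 : expR `|l * x| <= expR (`|x| / 2).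
  by rewrite ler_expR normrM mulrC ler_wpM2l.
have eE : expR `|x| = expR (`|x| / 2) * expR (`|x| / 2).
  by rewrite -expRD -splitr.
rewrite exprMn eE
  (_ : 16 * _ * _ = l ^+ 2 * (16 * expR (`|x| / 2) * expR (`|x| / 2))).
  rewrite -[leLHS]mulrA ler_wpM2l ?sqr_ge0// ler_pM ?sqr_ge0 ?expR_ge0//.
ring.
Qed.

Lemma sum_geometric_le (R : realType) (q : R) (n : nat) :
  0 <= q -> q < 1 -> \sum_(k < n) q ^+ k <= (1 - q)^-1.
Proof.
move=> q0 q1; rewrite -[leRHS]mul1r ler_pdivlMr ?subr_gt0//.
have := subrX1 q n; have : 0 <= q ^+ n by exact: exprn_ge0.
lra.
Qed.

(* The exponent on the left is the Legendre transform (up to a factor) of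
   [l |-> l ^+ 2] on [0 <= l <= s]; sampling the optimal [l] on a grid replaces
   the integration of Bernstein's tail bound. *)
Lemma expR_min_le_sum (R : realType) (c s g : R) :
  0 < c -> 1 <= s -> 0 <= g ->
  expR (c / 8 * Num.min (g ^+ 2) (s * g)) <=
  expR (c / 4) * \sum_(k < (Num.truncn s).+1)
    expR (- (3 / 4 * c * k%:R ^+ 2) + c * k%:R * g).
Proof.
move=> c0 s1 g0; set N := Num.truncn s.
have s0 : 0 <= s by lra.
have Ns : N%:R <= s by rewrite truncn_le.
have sN : s < N%:R + 1 by rewrite natr1 truncnS_gt.
suff [k kN hk] : exists2 k, (k < N.+1)%N & c / 8 * Num.min (g ^+ 2) (s * g) <=
    c / 4 + (- (3 / 4 * c * k%:R ^+ 2) + c * k%:R * g).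
  apply: (@le_trans _ _
    (expR (c / 4 + (- (3 / 4 * c * k%:R ^+ 2) + c * k%:R * g)))).
    by rewrite ler_expR.
  rewrite expRD (bigD1 (Ordinal kN))//= mulrDr lerDl mulr_ge0 ?expR_ge0//.
  by apply: sumr_ge0 => i _; exact: expR_ge0.
(* Inside the grid, take the integer part [k] of [g]: [c / 8 * (2 * k ^ 2 + 2)] is
   [c / 4 + c / 4 * k ^ 2], and [k <= g] makes the exponent of the summand at least
   [c / 4 * k ^ 2]. *)
have [gN|gN] := ltP g (N%:R + 1).
  exists (Num.truncn g).
    by rewrite truncn_lt_nat// -natr1.
  set k := (Num.truncn g)%:R.
  have kg : k <= g by rewrite truncn_le.
  have gk : g < k + 1 by rewrite natr1 truncnS_gt.
  have k0 : 0 <= k :> R by [].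
  have h1 : Num.min (g ^+ 2) (s * g) <= 2 * k ^+ 2 + 2.
    rewrite ge_min; apply/orP; left.
    have : g ^+ 2 <= (k + 1) ^+ 2 by rewrite lerXn2r ?nnegrE//; lra.
    have := sqr_ge0 (k - 1); lra.
  have h2 : c * Num.min (g ^+ 2) (s * g) <= c * (2 * k ^+ 2 + 2).
    by rewrite ler_wpM2l// ltW.
  have h3 : c * k * k <= c * k * g by rewrite ler_wpM2l// mulr_ge0// ltW.
  lra.
(* Beyond the grid the last point suffices: [s <= 2 * N] bounds the left side by [c / 4 * N * g],
   and [N <= g] leaves that much of the linear term. *)
exists N => //.
have N1 : 1 <= N%:R :> R.
  by rewrite ler1n truncn_gt0.
have h1 : c * (s * g) <= c * ((2 * N%:R) * g).
  by rewrite ler_wpM2l ?(ltW c0)// ler_wpM2r//; lra.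
have h2 : c * Num.min (g ^+ 2) (s * g) <= c * (s * g).
  by rewrite ler_wpM2l ?(ltW c0)// ge_min lexx orbT.
have h3 : c * N%:R * N%:R <= c * N%:R * g.
  by rewrite ler_wpM2l ?mulr_ge0 ?(ltW c0)//; lra.
lra.
Qed.

(** Convexity of [expR] between [w] and [0] with weights [1 / B] and [1 - 1 / B]. *)
Lemma expR_div_le (R : realType) (B w : R) :
  1 <= B -> expR (w / B) <= 1 + expR w / B.
Proof.
move=> B1; have B0 : 0 < B by lra.
have t01 : 0 <= B^-1 <= 1 by rewrite invr_ge0 (ltW B0)/= invf_le1.
have := convex_expR (Itv01 (proj1 (andP t01)) (proj2 (andP t01))) w 0.
rewrite !convRE/= mulr0 addr0 expR0 mulr1 /unstable.onem => h.
rewrite mulrC (le_trans h)// addrC [expR w / B]mulrC lerD2r.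
by rewrite gerBl invr_ge0 ltW.
Qed.

(** * Expectations of products of independent variables *)

Import HBNNSimple.
(** A factorization known for indicators of [Z] extends by linearity to simple functions of [Z], and
    by monotone convergence to every nonnegative measurable [f]. *)
Lemma ge0_integral_factor d (T : measurableType d) (R : realType)
    (mu : {measure set T -> \bar R}) (Z : {mfun T >-> R}) (g : T -> R) (c : R)
    (f : R -> R) :
  measurable_fun [set: T] g -> (forall w, 0 <= g w) ->
  (forall B, measurable B ->
    (\int[mu]_w (\1_B (Z w) * g w)%:E = mu (Z @^-1` B) * c%:E)%E) ->
  measurable_fun [set: R] f -> (forall x, 0 <= f x) ->
  (\int[mu]_w (f (Z w) * g w)%:E = (\int[mu]_w (f (Z w))%:E) * c%:E)%E.
Proof.
move=> mg g0 hc mf f0.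
have mf' : measurable_fun [set: R] (fun x => (f x)%:E).
  exact/measurable_EFinP.
pose h := nnsfun_approx measurableT mf'.
have hf x : (h n x)%:E @[n --> \oo] --> (f x)%:E.
  by apply: (cvg_nnsfun_approx measurableT mf') => // y _; rewrite lee_fin.
have mhZ n : measurable_fun [set: T] (h n \o Z) by exact: measurableT_comp.
have hnd x m n : (m <= n)%N -> h m x <= h n x.
  by move=> mn; exact/lefP/nd_nnsfun_approx.
have -> : (\int[mu]_w (f (Z w) * g w)%:E =
    limn (fun n => \int[mu]_w (h n (Z w) * g w)%:E))%E.
  rewrite -monotone_convergence//=.
  - apply: eq_integral => w _; apply/esym/cvg_lim => //.
    under eq_fun do rewrite EFinM.
    by rewrite EFinM; apply: cvgeZr.
  - by move=> n; apply/measurable_EFinP/measurable_funM => //; exact: mhZ.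
  - by move=> n w _; rewrite lee_fin mulr_ge0.
  - by move=> w _ m n mn; rewrite lee_fin ler_wpM2r ?hnd.
have -> : (\int[mu]_w (f (Z w))%:E =
    limn (fun n => \int[mu]_w (h n (Z w))%:E))%E.
  rewrite -monotone_convergence//=.
  - by apply: eq_integral => w _; apply/esym/cvg_lim.
  - by move=> n; apply/measurable_EFinP; exact: mhZ.
  - by move=> n w _; rewrite lee_fin.
  - by move=> w _ m n mn; rewrite lee_fin hnd.
rewrite -limeMr//; last first.
  apply/ereal_nondecreasing_is_cvgn => m n mn; apply: ge0_le_integral => //.
  - by move=> w _; rewrite lee_fin.
  - by apply/measurable_EFinP; exact: mhZ.
  - by apply/measurable_EFinP; exact: mhZ.
  - by move=> w _; rewrite lee_fin hnd.
congr (limn _); apply/funext => n.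
have hE x : h n x =
    \sum_(y <- fset_set (range (h n))) y * \1_(h n @^-1` [set y]) x.
  by rewrite [LHS]fimfunE fsbig_finite.
have y0 y : y \in fset_set (range (h n)) -> 0 <= y.
  by rewrite in_fset_set// inE => -[x _ <-].
have mB y : measurable (h n @^-1` [set y]) by [].
have mZB y : measurable (Z @^-1` (h n @^-1` [set y])).
  by rewrite -[X in measurable X]setTI; exact: measurable_funP.
have mI y : measurable_fun [set: T] (fun w => \1_(h n @^-1` [set y]) (Z w) : R).
  by apply: (measurableT_comp (measurable_indic _)).
(* Used with [k := g] and with [k := cst 1]: both sides become the same combination of integrals of
   indicators, to which [hc] applies. *)
have aux (k : T -> R) : measurable_fun [set: T] k -> (forall w, 0 <= k w) ->
  (\int[mu]_w (h n (Z w) * k w)%:E = \sum_(y <- fset_set (range (h n)))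
    (y%:E * \int[mu]_w (\1_(h n @^-1` [set y]) (Z w) * k w)%:E))%E.
  move=> mk k0.
  (* [Num.max 0 y] makes the summands nonnegative also off the range. *)
  transitivity (\int[mu]_w (\sum_(y <- fset_set (range (h n)))
      (Num.max 0 y * (\1_(h n @^-1` [set y]) (Z w) * k w))%:E)%E)%E.
    apply: eq_integral => w _; rewrite sumEFin hE mulr_suml; congr EFin.
    rewrite [LHS]big_seq [RHS]big_seq; apply: eq_bigr => y /y0 ?.
    by rewrite -mulrA max_r.
  have m1 y : measurable_fun [set: T]
    (fun w => (Num.max 0 y * (\1_(h n @^-1` [set y]) (Z w) * k w))%:E).
    by apply/measurable_EFinP/measurable_funM => //; exact/measurable_funM.
  rewrite ge0_integral_sum//; last first.
    by move=> y w _; rewrite lee_fin !mulr_ge0// le_max lexx.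
  rewrite [LHS]big_seq [RHS]big_seq; apply: eq_bigr => y /y0 y0'.
  under eq_integral do rewrite max_r// EFinM.
  rewrite ge0_integralZl//.
    by apply/measurable_EFinP/measurable_funM.
  by move=> w _; rewrite lee_fin mulr_ge0.
rewrite aux//; have := aux (cst 1).
under eq_integral do rewrite mulr1.
move=> -> //.
rewrite big_seq [X in (X * _)%E]big_seq ge0_sume_distrl; last first.
  move=> y /y0 y0'; rewrite mule_ge0 ?lee_fin// integral_ge0// => w _.
  by rewrite lee_fin mulr_ge0.
apply: eq_bigr => y /y0 y0'.
rewrite hc// muleA; congr (_ * _ * _)%E.
under eq_integral do rewrite mulr1.
rewrite -[RHS]/(\int[mu]_w (\1_(Z @^-1` (h n @^-1` [set y])) w)%:E)%E.
by rewrite integral_indic// setIT.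
Qed.

Lemma prod_indic_bigcap (R : realType) (T : Type) (I : finType)
    (A : I -> set T) (w : T) :
  \prod_i \1_(A i) w = \1_(\bigcap_(i in [set: I]) A i) w :> R.
Proof.
have [h|/existsNP[i /not_implyP[_ hi]]] :=
  pselect (forall i, [set: I] i -> A i w).
  rewrite big1 ?indicE ?mem_set// => i _; by rewrite indicE mem_set//; exact: h.
rewrite (bigD1 i)//= !indicE !memNset ?mul0r//; by move=> /(_ i Logic.I).
Qed.

Lemma independent_integral_prod d (T : measurableType d) (R : realType)
    (P : probability T R) (I : finType) (X : I -> {RV P >-> R})
    (f : I -> R -> R) (E : I -> R) :
  independent_RVs X ->
  (forall i, measurable_fun [set: R] (f i)) -> (forall i x, 0 <= f i x) ->
  (forall i, \int[P]_w (f i (X i w))%:E = (E i)%:E)%E ->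
  (\int[P]_w (\prod_i f i (X i w))%:E = (\prod_i E i)%:E)%E.
Proof.
move=> indX.
(* Outside [s] only indicators are allowed; [s] grows one index at a time. *)
suff claim (s : seq I) : forall (f : I -> R -> R) (E : I -> R),
    (forall i, measurable_fun [set: R] (f i)) -> (forall i x, 0 <= f i x) ->
    (forall i, \int[P]_w (f i (X i w))%:E = (E i)%:E)%E ->
    (forall i, i \notin s -> exists2 B, measurable B & f i = \1_B) ->
    (\int[P]_w (\prod_i f i (X i w))%:E = (\prod_i E i)%:E)%E.
  move=> mf f0 fE; apply: (claim (enum I)) => // i.
  by rewrite mem_enum.
elim: s => [|x s IH] {}f {}E mf f0 fE fB.
  (* With every factor an indicator, the claim is the product rule of [independent_RVs]. *)
  have {fB}/choice[B fB] : forall i, exists B, measurable B /\ f i = \1_B.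
    by move=> i; have [B ? ?] := fB i isT; exists B.
  have XB i : measurable (X i @^-1` B i).
    rewrite -[X in measurable X]setTI; apply: measurable_funP => //.
    by case: (fB i).
  transitivity
    (\int[P]_w (\1_(\bigcap_(i in [set: I]) (X i @^-1` B i)) w)%:E)%E.
    apply: eq_integral => w _; rewrite -prod_indic_bigcap; congr EFin.
    by apply: eq_bigr => i _; rewrite (fB i).2.
  rewrite integral_indic ?setIT//; last first.
    by apply: fin_bigcap_measurable => //; exact: finite_setT.
  rewrite [LHS](indX B (fun i => (fB i).1)).
  rewrite -prodEFin; apply: eq_bigr => i _.
  rewrite -fE (fB i).2 -[RHS]/(\int[P]_w (\1_(X i @^-1` B i) w)%:E)%E.
  by rewrite integral_indic// setIT.
under eq_integral do rewrite (bigD1 x)//=.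
rewrite (bigD1 x)//= EFinM -fE.
apply: (ge0_integral_factor (Z := X x)
  (g := fun w => \prod_(i | i != x) f i (X i w))) => //.
- under eq_fun do rewrite -big_filter.
  by apply: measurable_prod => i _; exact: measurableT_comp.
- by move=> w; exact: prodr_ge0.
move=> B mB.
have XB : measurable (X x @^-1` B).
  by rewrite -[X in measurable X]setTI; exact: measurable_funP.
(* Replacing the factor at [x] by an indicator removes [x] from the exceptional list, so the
   induction hypothesis supplies the factorization over indicators of [X x]. *)
pose f' i := if i == x then \1_B else f i.
pose E' i := if i == x then fine (P (X x @^-1` B)) else E i.
have prodE w : \prod_i f' i (X i w) =
    \1_B (X x w) * \prod_(i | i != x) f i (X i w).
  rewrite (bigD1 x)//= /f' eqxx; congr (_ * _).
  by apply: eq_bigr => i /negbTE ->.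
under eq_integral do rewrite -prodE.
rewrite (IH f' E').
- rewrite (bigD1 x)//= /E' eqxx EFinM fineK ?fin_num_measure//.
  congr (_ * _%:E)%E.
  by apply: eq_bigr => i /negbTE ->.
- by move=> i; rewrite /f'; case: ifP => // _; exact: measurable_indic.
- by move=> i y; rewrite /f'; case: ifP.
- move=> i; rewrite /f' /E'; case: eqVneq => // ->.
  rewrite -[LHS]/(\int[P]_w (\1_(X x @^-1` B) w)%:E)%E.
  by rewrite integral_indic// setIT fineK// fin_num_measure.
- move=> i si; rewrite /f'; case: eqVneq => [_|ix]; first by exists B.
  by apply: fB; rewrite inE negb_or ix.
Qed.

(** * Moment generating functions and a Bernstein-type bound *)

Lemma integral_expR_ge1D d (T : measurableType d) (R : realType)
    (P : probability T R) (y : T -> R) :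
  measurable_fun [set: T] y -> (forall w, 0 <= y w) ->
  (1%:E + \int[P]_w (y w)%:E <= \int[P]_w (expR (y w))%:E)%E.
Proof.
move=> my y0.
have my' : measurable_fun [set: T] (fun w => (y w)%:E).
  exact/measurable_EFinP.
have -> : (1%:E + \int[P]_w (y w)%:E = \int[P]_w (1%:E + (y w)%:E))%E.
  rewrite ge0_integralD//; last by move=> w _; rewrite lee_fin.
  by rewrite integral_cst//= probability_setT mule1.
apply: ge0_le_integral => //.
- by move=> w _; rewrite -EFinD lee_fin addr_ge0.
- exact: emeasurable_funD.
- by apply/measurable_EFinP/measurableT_comp.
- by move=> w _; rewrite -EFinD lee_fin expR_ge1Dx.
Qed.

(** In [expR_centered_le] at [x = y - m] the linear term integrates to 0. The remainder is at most
    [16 * l ^ 2 * expR 1 * 2], and [1 + u <= expR u] closes the bound. *)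
Lemma centered_mgf_le d (T : measurableType d) (R : realType)
    (P : probability T R) (y : T -> R) (m l : R) :
  measurable_fun [set: T] y -> (forall w, 0 <= y w) ->
  (\int[P]_w (expR (y w))%:E <= 2%:E)%E -> (\int[P]_w (y w)%:E = m%:E)%E ->
  `|l| <= 2^-1 ->
  (\int[P]_w (expR (l * (y w - m)))%:E <= (expR (32 * expR 1 * l ^+ 2))%:E)%E.
Proof.
move=> my y0 ey2 ym l2.
have mey : measurable_fun [set: T] (fun w => expR (y w)).
  exact: measurableT_comp.
have iy : P.-integrable [set: T] (fun w => (y w)%:E).
  apply/integrableP; split; first exact/measurable_EFinP.
  by under eq_integral do rewrite gee0_abs ?lee_fin//; rewrite ym ltry.
have ie : P.-integrable [set: T] (fun w => (expR (y w))%:E).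
  apply/integrableP; split; first exact/measurable_EFinP.
  under eq_integral do rewrite gee0_abs ?lee_fin ?expR_ge0//.
  by rewrite (le_lt_trans ey2)// ltry.
have i1 r : P.-integrable [set: T] (fun=> r%:E).
  exact: finite_measure_integrable_cst.
have int1 r : (\int[P]_w r%:E = r%:E)%E.
  by rewrite integral_cst//= probability_setT mule1.
have m0 : 0 <= m.
  by rewrite -lee_fin -ym integral_ge0// => w _; rewrite lee_fin.
have m1 : m <= 1.
  have := le_trans (integral_expR_ge1D P my y0) ey2.
  by rewrite ym -EFinD lee_fin; lra.
set a := 16 * l ^+ 2 * expR 1.
have a0 : 0 <= a by rewrite mulr_ge0 ?expR_ge0// mulr_ge0 ?sqr_ge0.
apply: (@le_trans _ _
  (\int[P]_w ((1 - l * m)%:E +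
    (l%:E * (y w)%:E + a%:E * (expR (y w))%:E)))%E).
  apply: ge0_le_integral => //.
  - apply/measurable_EFinP/measurableT_comp => //; apply: measurable_funM => //.
    exact: measurable_funB.
  - apply: (@measurable_int _ _ _ P); apply: integrableD => //.
    by apply: integrableD => //; exact: integrableZl.
  - move=> w _; rewrite -!EFinM -!EFinD lee_fin.
    apply: le_trans (expR_centered_le _ l2) _.
    (* Since [y >= 0] and [0 <= m <= 1], one has [|y - m| <= 1 + y]. *)
    have : expR `|y w - m| <= expR 1 * expR (y w).
      rewrite -expRD ler_expR ler_norml; have := y0 w; lra.
    have l0 : 0 <= 16 * l ^+ 2 by rewrite mulr_ge0 ?sqr_ge0.
    move/(ler_wpM2l l0); rewrite /a; lra.
rewrite integralD//; last first.
  by apply: integrableD => //; exact: integrableZl.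
rewrite integralD//; [|exact: integrableZl..].
rewrite !integralZl// int1 ym -EFinM addeA -EFinD subrK.
apply: (@le_trans _ _ (1%:E + a%:E * 2%:E)%E).
  by rewrite leeD2l// lee_wpmul2l// lee_fin.
rewrite -EFinM -EFinD lee_fin; apply: le_trans (expR_ge1Dx _).
rewrite /a; lra.
Qed.

Lemma sum_mgf_le d (T : measurableType d) (R : realType)
    (P : probability T R) (n : nat) (X : 'I_n -> {RV P >-> R})
    (phi : R -> R) (m l : R) :
  independent_RVs X ->
  measurable_fun [set: R] phi -> (forall x, 0 <= phi x) ->
  (forall i, (\int[P]_w (expR (phi (X i w)))%:E <= 2%:E)%E) ->
  (forall i, (\int[P]_w (phi (X i w))%:E = m%:E)%E) ->
  `|l| <= 2^-1 ->
  (\int[P]_w (expR (l * \sum_i (phi (X i w) - m)))%:E <=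
    (expR (32 * expR 1 * l ^+ 2 * n%:R))%:E)%E.
Proof.
move=> indX mphi phi0 e2 em l2.
pose f (i : 'I_n) x := expR (l * (phi x - m)).
have mf i : measurable_fun [set: R] (f i).
  apply: measurableT_comp => //; apply: measurable_funM => //.
  exact: measurable_funB.
have f0 i x : 0 <= f i x by exact: expR_ge0.
have mgf i : (\int[P]_w (f i (X i w))%:E <= (expR (32 * expR 1 * l ^+ 2))%:E)%E.
  by apply: centered_mgf_le => //; exact: measurableT_comp.
have int0 i : (0 <= \int[P]_w (f i (X i w))%:E)%E.
  by apply: integral_ge0 => w _; rewrite lee_fin.
pose E i := fine (\int[P]_w (f i (X i w))%:E)%E.
have fE i : (\int[P]_w (f i (X i w))%:E = (E i)%:E)%E.
  by rewrite fineK// ge0_fin_numE// (le_lt_trans (mgf i))// ltry.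
under eq_integral do rewrite mulr_sumr expR_sum.
rewrite (independent_integral_prod indX mf f0 fE) lee_fin.
rewrite mulrC expRM_natl -[X in _ ^+ X]card_ord -prodr_const.
by apply: ler_prod => i _; rewrite -!lee_fin -fE mgf int0.
Qed.

(** Calibrated so that the exponent [32 * expR 1 * l ^ 2 * n] of [sum_mgf_le] equals [c / 2 * k ^ 2]
    at [l = c * k / sqrt n]. *)
Definition bernstein_rate (R : realType) : R := (64 * expR 1)^-1.

(** Apply [expR_min_le_sum] to [g = G / sqrt n] and [s = sqrt n]. The [k]-th term has weight
    [- 3 / 4 * c * k ^ 2] against a moment exponent [c / 2 * k ^ 2], so its expectation decays like
    [expR (- c / 4 * k ^ 2)] and the sum is bounded independently of [n]. *)
Lemma exp_deviation_le d (T : measurableType d) (R : realType)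
    (P : probability T R) (n : nat) (X : 'I_n -> {RV P >-> R})
    (phi : R -> R) (m : R) (c := bernstein_rate R)
    (G := fun w => `|\sum_i (phi (X i w) - m)|) :
  (0 < n)%N ->
  independent_RVs X ->
  measurable_fun [set: R] phi -> (forall x, 0 <= phi x) ->
  (forall i, (\int[P]_w (expR (phi (X i w)))%:E <= 2%:E)%E) ->
  (forall i, (\int[P]_w (phi (X i w))%:E = m%:E)%E) ->
  (\int[P]_w (expR (c / 8 * Num.min (G w ^+ 2 / n%:R) (G w)))%:E <=
   (2 * expR (c / 4) / (1 - expR (- (c / 4))))%:E)%E.
Proof.
move=> n0 indX mphi phi0 e2 em.
have c0 : 0 < c by rewrite invr_gt0 mulr_gt0 ?expR_gt0.
have c2 : c <= 2^-1.
  rewrite lef_pV2 ?posrE ?mulr_gt0 ?expR_gt0//.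
  have := expR_ge1Dx (1 : R); lra.
set S := fun w => \sum_i (phi (X i w) - m).
have mS : measurable_fun [set: T] S.
  apply: measurable_sum => i; apply: measurable_funB => //.
  exact: measurableT_comp.
pose s : R := Num.sqrt n%:R.
have s2 : s ^+ 2 = n%:R by rewrite sqr_sqrtr.
have s1 : 1 <= s by rewrite -[leLHS]sqrtr1 ler_wsqrtr// ler1n.
have s0 : 0 < s by lra.
set N := Num.truncn s.
pose l (k : nat) := c * k%:R / s.
pose D (k : nat) := expR (c / 4) * expR (- (3 / 4 * c * k%:R ^+ 2)).
have D0 k : 0 <= D k by rewrite mulr_ge0 ?expR_ge0.
have ml r : measurable_fun [set: T] (fun w => expR (r * S w)).
  by apply: measurableT_comp => //; exact: measurable_funM.
(* The two signs together dominate [expR (l k * |S w|)]; this is the source of the factor 2. *)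
pose h (k : 'I_N.+1) w := D k * (expR (l k * S w) + expR (- l k * S w)).
have mh k : measurable_fun [set: T] (h k).
  by apply: measurable_funM => //; exact: measurable_funD.
have h0 k w : 0 <= h k w by rewrite mulr_ge0 ?addr_ge0 ?expR_ge0.
have pt w : expR (c / 8 * Num.min (G w ^+ 2 / n%:R) (G w)) <= \sum_k h k w.
  have -> : Num.min (G w ^+ 2 / n%:R) (G w) =
      Num.min ((G w / s) ^+ 2) (s * (G w / s)).
    by rewrite expr_div_n s2 mulrCA divff ?mulr1// gt_eqF.
  apply: (le_trans (expR_min_le_sum c0 s1 _)).
    by apply: divr_ge0; [exact: normr_ge0|exact: ltW].
  rewrite mulr_sumr; apply: ler_sum => k _.
  rewrite expRD mulrA ler_wpM2l//.
  have -> : c * k%:R * (G w / s) = l k * `|S w| by rewrite /l mulrA mulrAC.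
  have [Sw|Sw] := ger0P (S w); first by rewrite lerDl expR_ge0.
  by rewrite mulrN -mulNr lerDr expR_ge0.
apply: (@le_trans _ _ (\int[P]_w (\sum_k (h k w)%:E)%E)%E).
  apply: ge0_le_integral => //.
  - apply/measurable_EFinP/measurableT_comp => //; apply: measurable_funM => //.
    have mG : measurable_fun [set: T] G by exact: measurableT_comp.
    apply: measurable_minr => //; apply: measurable_funM => //.
    exact: measurable_funX.
  - by apply: emeasurable_sum => k; exact/measurable_EFinP.
  - by move=> w _; rewrite sumEFin lee_fin.
rewrite ge0_integral_sum//; last 2 first.
- by move=> k; exact/measurable_EFinP.
- by move=> k w _; rewrite lee_fin.
(* The grid stops at [N <= s], hence [l k <= c <= 1 / 2], the range where the moment bound holds. *)
have lk (k : 'I_N.+1) : `|l k| <= 2^-1.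
  apply: le_trans c2.
  rewrite ger0_norm ?divr_ge0 ?mulr_ge0 ?(ltW c0) ?(ltW s0)//.
  rewrite /l -mulrA ler_piMr ?(ltW c0)// ler_pdivrMr// mul1r.
  have : (k%:R <= N%:R :> R) by rewrite ler_nat -ltnS.
  move/le_trans; apply; by rewrite truncn_le// ltW.
have hk (k : 'I_N.+1) : (\int[P]_w (h k w)%:E <=
    (2 * expR (c / 4) * expR (- (c / 4)) ^+ k)%:E)%E.
  under eq_integral do rewrite EFinM EFinD.
  rewrite ge0_integralZl//; last 3 first.
  - by under eq_fun do rewrite -EFinD; apply/measurable_EFinP/measurable_funD.
  - by move=> w _; rewrite -EFinD lee_fin addr_ge0 ?expR_ge0.
  - by rewrite lee_fin.
  rewrite ge0_integralD//; [|exact/measurable_EFinP..].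
  set b := expR (32 * expR 1 * l k ^+ 2 * n%:R).
  have b1 := sum_mgf_le indX mphi phi0 e2 em (lk k).
  have b2 : (\int[P]_w (expR (- l k * S w))%:E <= b%:E)%E.
    rewrite /b -sqrrN; apply: sum_mgf_le => //; by rewrite normrN.
  apply: (@le_trans _ _ ((D k)%:E * (b%:E + b%:E))%E).
    by rewrite lee_wpmul2l ?lee_fin// leeD.
  rewrite -EFinD -EFinM lee_fin /D /b.
  have -> : 32 * expR 1 * l k ^+ 2 * n%:R = c / 2 * k%:R ^+ 2.
    rewrite /l -s2 expr_div_n -[LHS]mulrA divfK ?expf_neq0 ?gt_eqF//.
    rewrite /c /bernstein_rate. field. by rewrite gt_eqF ?expR_gt0.
  have eqM (x y z : R) : x * y * (z + z) = 2 * x * (y * z) by ring.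
  rewrite eqM.
  rewrite ler_wpM2l ?mulr_ge0 ?expR_ge0//.
  rewrite -expRD -expRM_natl ler_expR.
  (* Trades the Gaussian decay in [k] for a geometric one. *)
  have : (k%:R <= k%:R ^+ 2 :> R).
    rewrite -natrX ler_nat; case: (k : nat) => // k'.
    by rewrite -mulnn leq_pmull.
  move/(ler_wpM2l (ltW c0)). lra.
apply: (le_trans (lee_sum _ (fun k _ => hk k))).
rewrite sumEFin lee_fin -mulr_sumr ler_wpM2l ?mulr_ge0 ?expR_ge0//.
apply: sum_geometric_le; rewrite ?expR_ge0// expR_lt1; lra.
Qed.

(** * Properties of the psi-norm and its finiteness *)

Lemma measurable_norm_powR d (T : measurableType d) (R : realType)
    (p : R) (f : T -> R) :
  measurable_fun [set: T] f -> measurable_fun [set: T] (fun w => `|f w| `^ p).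
Proof.
move=> mf; apply: (@measurableT_comp _ _ _ _ _ _ (fun x => x `^ p)) => //.
exact: measurableT_comp.
Qed.

Lemma measurable_expR_powR d (T : measurableType d) (R : realType)
    (p : R) (f : T -> R) :
  measurable_fun [set: T] f ->
  measurable_fun [set: T] (fun w => expR (`|f w| `^ p)).
Proof.
by move=> mf; apply: measurableT_comp => //; exact: measurable_norm_powR.
Qed.

(** Integrating [expR_div_le] gives [1 + B / B = 2]: any bound on the exponential moment is lowered
    to the 2 of the psi-norm by shrinking the exponent. *)
Lemma integral_expR_div_le2 d (T : measurableType d) (R : realType)
    (P : probability T R) (V : T -> R) (B : R) :
  measurable_fun [set: T] V -> 1 <= B ->
  (\int[P]_w (expR (V w))%:E <= B%:E)%E ->
  (\int[P]_w (expR (V w / B))%:E <= 2%:E)%E.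
Proof.
move=> mV B1 eB; have B0 : 0 < B by lra.
have meV : measurable_fun [set: T] (fun w => (expR (V w))%:E).
  exact/measurable_EFinP/measurableT_comp.
apply: (@le_trans _ _ (\int[P]_w (1%:E + B^-1%:E * (expR (V w))%:E))%E).
  apply: ge0_le_integral => //.
  - by apply/measurable_EFinP/measurableT_comp => //; exact: measurable_funM.
  - by apply: emeasurable_funD => //; exact: emeasurable_funM.
  - by move=> w _; rewrite -EFinM -EFinD lee_fin [B^-1 * _]mulrC expR_div_le.
rewrite ge0_integralD//; last 2 first.
- by move=> w _; rewrite -EFinM lee_fin mulr_ge0 ?expR_ge0// invr_ge0 ltW.
- exact: emeasurable_funM.
rewrite ge0_integralZl//; last by rewrite lee_fin invr_ge0 ltW.
rewrite integral_cst//= probability_setT mule1.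
rewrite (_ : 2%:E = 1%:E + B^-1%:E * B%:E)%E; last first.
  by rewrite -EFinM -EFinD mulVf ?gt_eqF.
by rewrite leeD2l// lee_wpmul2l// lee_fin invr_ge0 ltW.
Qed.

Lemma psi_norm_le d (T : measurableType d) (R : realType)
    (P : probability T R) (p K : R) (Y : T -> R) :
  0 < K -> (\int[P]_w (expR (`|Y w / K| `^ p))%:E <= 2%:E)%E ->
  (psi_norm P p Y <= K%:E)%E.
Proof.
move=> K0 eK; apply: ereal_inf_lbound; exists K => //; split => //.
by rewrite unlock.
Qed.

Lemma psi_norm_ge0 d (T : measurableType d) (R : realType)
    (P : probability T R) (p : R) (Y : T -> R) : (0 <= psi_norm P p Y)%E.
Proof.
by apply: le_ereal_inf_tmp => _ [K [K0 _] <-]; rewrite lee_fin ltW.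
Qed.

(** Some admissible radius lies below [K], and the exponential moment decreases as the radius
    grows. *)
Lemma psi_norm_lt d (T : measurableType d) (R : realType)
    (P : probability T R) (p K : R) (Y : T -> R) :
  0 <= p -> measurable_fun [set: T] Y -> (psi_norm P p Y < K%:E)%E ->
  (\int[P]_w (expR (`|Y w / K| `^ p))%:E <= 2%:E)%E.
Proof.
move=> p0 mY /ereal_inf_lt[_ [K' [K'0 +] <-]]; rewrite lte_fin unlock => e2 K'K.
apply: le_trans e2; apply: ge0_le_integral => //.
- by apply/measurable_EFinP/measurable_expR_powR; exact: measurable_funM.
- by apply/measurable_EFinP/measurable_expR_powR; exact: measurable_funM.
move=> w _; rewrite lee_fin ler_expR ge0_ler_powR ?nnegrE//.
have K0 : 0 < K by lra.
rewrite !normrM ler_wpM2l// !ger0_norm ?invr_ge0 ?ltW//.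
by rewrite ltf_pV2.
Qed.

(** With [V = |Y / C| ^ p], the tail gives [P (V >= k) <= c * expR (- k)]. Halving the exponent
    makes [expR (V / 2)] integrable by summing over unit layers of [V]; enlarging the radius then
    lowers the bound to 2. *)
Lemma sub_exponential_psi_norm d (T : measurableType d) (R : realType)
    (P : probability T R) (p : R) (Y : T -> R) :
  0 < p -> measurable_fun [set: T] Y -> sub_exponential P p Y ->
  (psi_norm P p Y < +oo)%E.
Proof.
move=> p0 mY [c [C [c0 C0 tail]]].
pose V w := `|Y w / C| `^ p.
have mV : measurable_fun [set: T] V.
  by apply: measurable_norm_powR; exact: measurable_funM.
have V0 w : 0 <= V w by exact: powR_ge0.
pose A k := [set w | k%:R <= V w].
have mA k : measurable (A k).
  rewrite -[A k]setTI.
  exact: (measurable_fun_le measurableT (measurable_cst _) mV).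
pose q : R := expR (- 2^-1).
have q0 : 0 <= q by exact: expR_ge0.
have q1 : q < 1 by rewrite expR_lt1; lra.
(* Dominates [expR (V / 2)] on the layer [k <= V < k + 1]; against the tail it leaves
   [c * expR (1 / 2) * q ^ k]. *)
pose a (k : nat) : R := expR (2^-1 * (k%:R + 1)).
have PA k : (P (A k) <= (c * expR (- k%:R))%:E)%E.
  (* The level at which [(t / C) ^ p = k]. *)
  pose t := C * k%:R `^ p^-1.
  have t0 : 0 <= t by rewrite mulr_ge0 ?powR_ge0// ltW.
  apply: (@le_trans _ _ (P [set w | t <= `|Y w|])).
    apply: le_measure; rewrite ?inE//.
      rewrite -[X in measurable X]setTI.
      apply: (measurable_fun_le measurableT (measurable_cst _)).
      exact: measurableT_comp.
    move=> w /= kV; rewrite /t mulrC -ler_pdivlMr//.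
    have -> : `|Y w| / C = V w `^ p^-1.
      rewrite -powRrM mulfV ?gt_eqF// powRr1// normrM (@ger0_norm _ C^-1)//.
      by rewrite invr_ge0 ltW.
    by rewrite ge0_ler_powR ?nnegrE// invr_ge0 ltW.
  apply: le_trans (tail _ t0) _.
  rewrite lee_fin /t mulrAC divff ?gt_eqF// mul1r -powRrM mulVf ?gt_eqF//.
  by rewrite powRr1.
have a0 k : 0 <= a k by exact: expR_ge0.
have ge0A k w : (0 <= (a k * \1_(A k) w)%:E)%E by rewrite lee_fin mulr_ge0.
have expV w : ((expR (2^-1 * V w))%:E <= \sum_(k <oo) (a k * \1_(A k) w)%:E)%E.
  set k := Num.truncn (V w).
  apply: le_trans (nneseries_lim_ge k.+1 _) => //.
  rewrite big_nat_recr//=.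
  have h : ((expR (2^-1 * V w))%:E <= (a k * \1_(A k) w)%:E)%E.
    rewrite lee_fin indicE mem_set ?mulr1; last by rewrite /A/= truncn_le.
    rewrite ler_expR ler_wpM2l// ltW// natr1; exact: truncnS_gt.
  apply: (le_trans h); rewrite leeDr//; apply: sume_ge0 => i _; exact: ge0A.
have bound : (\int[P]_w (expR (2^-1 * V w))%:E <=
    (c * expR 2^-1 / (1 - q))%:E)%E.
  apply: (@le_trans _ _ (\int[P]_w (\sum_(k <oo) (a k * \1_(A k) w)%:E))%E).
    apply: ge0_le_integral => //.
    - by apply/measurable_EFinP/measurableT_comp => //; exact: measurable_funM.
    - apply: ge0_emeasurable_sum => [k w _ _|k _]; first exact: ge0A.
      apply/measurable_EFinP.
      by apply: measurable_funM => //; exact: measurable_indic.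
  rewrite integral_nneseries//; last first.
    move=> k; apply/measurable_EFinP.
    by apply: measurable_funM => //; exact: measurable_indic.
  apply: lime_le.
    by apply: is_cvg_nneseries => k _ _; apply: integral_ge0.
  apply: nearW => n.
  apply: (@le_trans _ _ (\sum_(0 <= k < n) (c * expR 2^-1 * q ^+ k)%:E)%E).
    apply: lee_sum => k _.
    under eq_integral do rewrite EFinM.
    have mI : measurable_fun [set: T] (fun w => (\1_(A k) w : R)%:E).
      by apply/measurable_EFinP; exact: measurable_indic.
    rewrite ge0_integralZl//; last by rewrite lee_fin.
    rewrite integral_indic// setIT.
    apply: (@le_trans _ _ ((a k)%:E * (c * expR (- k%:R))%:E)%E).
      by apply: lee_wpmul2l; [rewrite lee_fin|exact: PA].
    rewrite -EFinM lee_fin /a /q -expRM_natl mulrCA -!mulrA.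
    rewrite ler_wpM2l ?(ltW c0)//.
    rewrite -!expRD ler_expR; lra.
  rewrite sumEFin lee_fin -mulr_sumr ler_wpM2l ?mulr_ge0 ?expR_ge0 ?(ltW c0)//.
  by rewrite big_mkord sum_geometric_le.
pose B := 1 + c * expR 2^-1 / (1 - q).
have B1 : 1 <= B.
  by rewrite lerDl divr_ge0 ?mulr_ge0 ?expR_ge0 ?(ltW c0)// subr_ge0 ltW.
have B0 : 0 < B by lra.
(* Enlarging the radius [C] by [e] divides [V] by [2 * B]: the 2 is the halved exponent, [B] the
   loss in [integral_expR_div_le2]. *)
pose e := (2 * B) `^ p^-1.
have e0 : 0 < e by rewrite powR_gt0// mulr_gt0.
have ep : e^-1 `^ p = (2 * B)^-1.
  have eB : e `^ p = 2 * B.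
    by rewrite /e -powRrM mulVf ?gt_eqF// powRr1// mulr_ge0// ltW.
  by rewrite -powR_inv1 ?(ltW e0)// powRAC eB powR_inv1// mulr_ge0// ltW.
pose K := C * e.
have K0 : 0 < K by exact: mulr_gt0.
apply: (@le_lt_trans _ _ K%:E); last exact: ltry.
apply: psi_norm_le => //.
have -> : (fun w => (expR (`|Y w / K| `^ p))%:E) =
    (fun w => (expR (2^-1 * V w / B))%:E).
  apply/funext => w; congr (expR _)%:E.
  rewrite /K invfM mulrA normrM powRM// -/(V w).
  rewrite (@ger0_norm _ e^-1) ?invr_ge0 ?(ltW e0)//.
  by rewrite ep invfM mulrA [V w * _]mulrC.
apply: integral_expR_div_le2 => //; first exact: measurable_funM.
by apply: (le_trans bound); rewrite lee_fin lerDr.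
Qed.

(** * Rescaling the deviation, and moments against psi-norms *)

Lemma powR_normV (R : realType) (p x k : R) :
  0 < k -> `|x / k| `^ p = (k `^ p)^-1 * `|x| `^ p.
Proof.
move=> k0; rewrite normrM (@ger0_norm _ k^-1) ?invr_ge0 ?(ltW k0)//.
rewrite powRM ?invr_ge0 ?(ltW k0)// mulrC; congr (_ * _).
by rewrite -powR_inv1 ?(ltW k0)// powRAC powR_inv1 ?powR_ge0.
Qed.

(** Divide the two bounds of [dist_powR_le_sqr], at [mu ^ p = N * L ^ p], by [M ^ p]. The radius
    condition reads [A * k * k <= M * L]; its [p]-th power serves the quadratic bound and, after
    [L <= k], the linear one. *)
Lemma deviation_rate_le (R : realType) (p k L M A N z : R)
    (D := `|z `^ p - N * L `^ p| / k `^ p) :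
  2 <= p -> 0 < L -> L <= k -> 1 <= A -> A * (k / L) * k <= M ->
  0 < N -> 0 <= z ->
  `|(z - N `^ p^-1 * L) / M| `^ p <= A^-1 * Num.min (D ^+ 2 / N) D.
Proof.
move=> p2 L0 Lk A1 AM N0 z0.
have p0 : 0 < p by lra.
have A0 : 0 < A by lra.
have k0 : 0 < k by lra.
have kL0 : 0 < k / L by exact: divr_gt0.
have M0 : 0 < M by apply: lt_le_trans AM; rewrite mulr_gt0// mulr_gt0.
have kp0 : 0 < k `^ p by exact: powR_gt0.
have Lp0 : 0 < L `^ p by exact: powR_gt0.
have Mp0 : 0 < M `^ p by exact: powR_gt0.
have muE : (N `^ p^-1 * L) `^ p = N * L `^ p.
  rewrite powRM ?powR_ge0 ?(ltW L0)// -powRrM mulVf ?gt_eqF// powRr1//.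
  exact: ltW.
have [d1 d2] := @dist_powR_le_sqr R p z (N `^ p^-1 * L) p2 z0
  (mulr_ge0 (powR_ge0 _ _) (ltW L0)).
rewrite muE in d1 d2.
rewrite powR_normV//; set d := `|z - _| `^ p in d1 d2 *.
have d0 : 0 <= d by exact: powR_ge0.
have LkP : L `^ p <= k `^ p by rewrite ge0_ler_powR ?nnegrE// ltW.
(* [A >= 1] enters through [A <= A ^ p]. *)
have Mlow : A * k `^ p * k `^ p <= M `^ p * L `^ p.
  have h : A * k * k <= M * L.
    have -> : A * k * k = A * (k / L) * k * L by field; rewrite gt_eqF.
    by rewrite ler_pM2r.
  rewrite -powRM ?(ltW M0) ?(ltW L0)//.
  apply: (@le_trans _ _ ((A * k * k) `^ p)); last first.
    have [[A0' k0'] [M0' L0']] := ((ltW A0, ltW k0), (ltW M0, ltW L0)).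
    by rewrite ge0_ler_powR ?nnegrE ?mulr_ge0 ?(ltW p0).
  rewrite !powRM ?mulr_ge0 ?(ltW A0) ?(ltW k0)//.
  rewrite ler_wpM2r ?(ltW kp0)// ler_wpM2r ?(ltW kp0)//.
  by apply: le1r_powR => //; lra.
have Mlow' : A * k `^ p <= M `^ p.
  rewrite -(ler_pM2r kp0); apply: (le_trans Mlow).
  by rewrite ler_pM2l.
set dev := `|z `^ p - N * L `^ p| in d1 d2 D *.
have dev0 : 0 <= dev by exact: normr_ge0.
rewrite minr_pMr ?invr_ge0 ?(ltW A0)// le_min; apply/andP; split.
  rewrite mulrC ler_pdivrMr//.
  apply: (@le_trans _ _ (dev ^+ 2 / (N * L `^ p))).
    by rewrite ler_pdivlMr// mulr_gt0.
  rewrite (_ : A^-1 * (D ^+ 2 / N) * M `^ p =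
     dev ^+ 2 / (N * L `^ p) * ((M `^ p * L `^ p) / (A * k `^ p * k `^ p))).
    rewrite ler_peMr ?divr_ge0 ?mulr_ge0 ?sqr_ge0 ?(ltW N0) ?(ltW Lp0)//.
    by rewrite ler_pdivlMr ?mul1r// mulr_gt0// mulr_gt0.
  by rewrite /D; field; rewrite !gt_eqF.
rewrite mulrC ler_pdivrMr//; apply: (le_trans d1).
have -> : A^-1 * D * M `^ p = dev * (M `^ p / (A * k `^ p)).
  by rewrite /D; field; rewrite !gt_eqF.
by rewrite ler_peMr// ler_pdivlMr ?mul1r// mulr_gt0.
Qed.

Lemma lp_norm_powR (R : realType) (n : nat) (p : R) (x : 'I_n -> R) :
  0 < p -> lp_norm p x `^ p = \sum_i `|x i| `^ p.
Proof.
move=> p0; rewrite /lp_norm -powRrM mulVf ?gt_eqF// powRr1// sumr_ge0//.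
Qed.

Lemma integral_powR_normV d (T : measurableType d) (R : realType)
    (mu : {measure set T -> \bar R}) (p k M : R) (Y : T -> R) :
  measurable_fun [set: T] Y -> 0 < k ->
  (\int[mu]_w (`|Y w| `^ p)%:E = M%:E)%E ->
  (\int[mu]_w (`|Y w / k| `^ p)%:E = (M / k `^ p)%:E)%E.
Proof.
move=> mY k0 YM.
under eq_integral do rewrite powR_normV// EFinM.
rewrite ge0_integralZl ?YM -?EFinM 1?mulrC//.
- by apply/measurable_EFinP; exact: measurable_norm_powR.
- by rewrite lee_fin invr_ge0 powR_ge0.
Qed.

(** Integrating [1 + y <= expR y] at [y = |Y / k| ^ p] bounds the mean of [y] by [2 - 1]. *)
Lemma integral_powR_le d (T : measurableType d) (R : realType)
    (P : probability T R) (p k : R) (Y : T -> R) :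
  measurable_fun [set: T] Y -> 0 < k ->
  (\int[P]_w (expR (`|Y w / k| `^ p))%:E <= 2%:E)%E ->
  (\int[P]_w (`|Y w| `^ p)%:E <= (k `^ p)%:E)%E.
Proof.
move=> mY k0 e2.
have kp0 : 0 < k `^ p by exact: powR_gt0.
have mYk : measurable_fun [set: T] (fun w => `|Y w / k| `^ p).
  by apply: measurable_norm_powR; exact: measurable_funM.
have h1 := integral_expR_ge1D P mYk (fun w => powR_ge0 _ _).
rewrite (_ : (fun w => (`|Y w| `^ p)%:E) =
    (fun w => (k `^ p)%:E * (`|Y w / k| `^ p)%:E)%E); last first.
  by apply/funext => w; rewrite -EFinM powR_normV// mulrA mulfV ?gt_eqF// mul1r.
rewrite ge0_integralZl//; last 2 first.
- by apply/measurable_EFinP; exact: mYk.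
- by rewrite lee_fin ltW.
rewrite -[leRHS]mule1 lee_wpmul2l ?lee_fin ?(ltW kp0)//.
have : (1%:E + \int[P]_w (`|Y w / k| `^ p)%:E <= 2%:E)%E.
  exact: le_trans h1 e2.
case: (\int[P]_w _)%E => [r| |]//; last by move=> _; rewrite leNye.
rewrite -EFinD !lee_fin; lra.
Qed.

(** [Y] vanishes almost everywhere, so every positive radius has exponential moment [1 <= 2]. This
    settles the degenerate case [L = 0]. *)
Lemma psi_norm_eq0 d (T : measurableType d) (R : realType)
    (P : probability T R) (p : R) (Y : T -> R) :
  0 < p -> measurable_fun [set: T] Y ->
  (\int[P]_w (`|Y w| `^ p)%:E = 0)%E -> psi_norm P p Y = 0%E.
Proof.
move=> p0 mY Y0; apply/eqP; rewrite eq_le psi_norm_ge0 andbT.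
apply/lee_addgt0Pr => e e0; rewrite add0e; apply: psi_norm_le => //.
have mp : measurable_fun [set: T] (fun w => (`|Y w| `^ p)%:E).
  by apply/measurable_EFinP; exact: measurable_norm_powR.
have ae0 : ae_eq P [set: T] (fun w => (`|Y w| `^ p)%:E) (cst 0%E).
  apply/(ae_eq_integral_abs P measurableT mp); rewrite -[RHS]Y0.
  by apply: eq_integral => w _; rewrite gee0_abs// lee_fin powR_ge0.
rewrite (ae_eq_integral (cst 1%E))//; last 2 first.
- by apply/measurable_EFinP/measurable_expR_powR; exact: measurable_funM.
- apply: filterS ae0 => w /= /(_ I)[Yw] _.
  by rewrite powR_normV// Yw mulr0 expR0.
by rewrite integral_cst//= probability_setT mul1e lee_fin ler1n.
Qed.

Lemma Lp_normE d (T : measurableType d) (R : realType)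
    (P : probability T R) (p M : R) (Y : T -> R) :
  (\int[P]_w (`|Y w| `^ p)%:E = M%:E)%E -> Lp_norm P p Y = M `^ p^-1.
Proof. by move=> YM; rewrite /Lp_norm unlock/= YM. Qed.

Lemma psi_norm_le_max d (T : measurableType d) (R : realType)
    (P : probability T R) (n : nat) (p : R) (X : 'I_n -> {RV P >-> R})
    (i : 'I_n) :
  (forall i, (psi_norm P p (X i) < +oo)%E) ->
  (psi_norm P p (X i) <= (max_psi_norm p X)%:E)%E.
Proof.
move=> fin; have le_max := le_bigmax -oo%E (fun i => psi_norm P p (X i)) i.
rewrite /max_psi_norm fineK// ge0_fin_numE.
  by apply: bigmax_lt => // j _; exact: fin.
exact: le_trans (psi_norm_ge0 _ _ _) le_max.
Qed.

(** * Concentration of the [p]-norm in the psi-norm *)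

Theorem theorem1p4 (R : realType) :
  exists C : R, 0 < C /\
    forall (d : measure_display) (T : measurableType d) (P : probability T R)
      (n : nat) (p : R) (X : 'I_n.+1 -> {RV P >-> R}),
      2 <= p ->
      independent_RVs X ->
      (forall i : 'I_n.+1, sub_exponential P p (X i)) ->
      (forall i : 'I_n.+1,
         ('E_P[fun w => (`|X ord0 w| `^ p)%R] =
          'E_P[fun w => (`|X i w| `^ p)%R])%E) ->
      let K := max_psi_norm p X in
      let L := Lp_norm P p (X ord0) in
      (psi_norm P p
         (fun w => lp_norm p (fun i => X i w) - (n.+1)%:R `^ p^-1 * L)%R
       <= (6 `^ p^-1 * C * (K / L) `^ (p - 1) * K)%:E)%E.
Proof.
pose c := bernstein_rate R.
have c0 : 0 < c by rewrite invr_gt0 mulr_gt0 ?expR_gt0.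
have c1 : c < 1.
  rewrite invf_lt1 ?mulr_gt0 ?expR_gt0//; have := expR_ge1Dx (1 : R); lra.
(* The bound of [exp_deviation_le], plus 1 to ensure [B >= 1]. *)
pose B := 1 + 2 * expR (c / 4) / (1 - expR (- (c / 4))).
have B1 : 1 <= B.
  rewrite lerDl divr_ge0 ?mulr_ge0 ?expR_ge0// subr_ge0 expR_le1; lra.
(* [A^-1] is the exponent rate [c / 8] divided by the cost [B] of lowering the bound to 2. *)
pose A := 8 / c * B.
have A1 : 1 <= A.
  have : 1 <= 8 / c by rewrite ler_pdivlMr//; lra.
  by move=> ?; rewrite /A mulr_ege1.
exists (4 * A); split; first lra.
move=> d T P n p X p2 indX subX eqX; cbv zeta.
set K := max_psi_norm p X; set L := Lp_norm P p (X ord0).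
have p0 : 0 < p by lra.
have mX i : measurable_fun [set: T] (X i) by exact: measurable_funP.
have psi_lty i : (psi_norm P p (X i) < +oo)%E.
  exact: sub_exponential_psi_norm.
have psiK i : (psi_norm P p (X i) <= K%:E)%E by exact: psi_norm_le_max.
have K0 : 0 <= K.
  by rewrite -lee_fin; exact: le_trans (psi_norm_ge0 _ _ _) (psiK ord0).
have e2 k i : K < k -> (\int[P]_w (expR (`|X i w / k| `^ p))%:E <= 2%:E)%E.
  move=> Kk; apply: psi_norm_lt => //; first exact: ltW.
  by apply: le_lt_trans (psiK i) _; rewrite lte_fin.
have momk k i : K < k -> (\int[P]_w (`|X i w| `^ p)%:E <= (k `^ p)%:E)%E.
  move=> Kk; apply: integral_powR_le => //; last exact: e2.
  exact: le_lt_trans K0 Kk.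
have intX0 : (0 <= \int[P]_w (`|X ord0 w| `^ p)%:E)%E.
  by apply: integral_ge0 => w _; rewrite lee_fin powR_ge0.
pose M := fine (\int[P]_w (`|X ord0 w| `^ p)%:E)%E.
have M0 : 0 <= M by exact: fine_ge0.
have XM i : (\int[P]_w (`|X i w| `^ p)%:E = M%:E)%E.
  have := eqX i; rewrite unlock => <-; rewrite fineK// ge0_fin_numE//.
  by apply: le_lt_trans (momk (K + 1) ord0 _) _; rewrite ?ltry// ltrDl.
have LM : L = M `^ p^-1 by exact: Lp_normE.
have LpM : L `^ p = M by rewrite LM -powRrM mulVf ?gt_eqF// powRr1.
have L0 : 0 <= L by rewrite LM powR_ge0.
(* The moment bound holds at every radius [K + e]; let [e] tend to 0. *)
have LK : L <= K.
  apply/ler_addgt0Pr => e e0.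
  have Ke : K < K + e by rewrite ltrDl.
  have := momk _ ord0 Ke; rewrite XM lee_fin => MK.
  have -> : K + e = ((K + e) `^ p) `^ p^-1.
    by rewrite -powRrM mulfV ?gt_eqF// powRr1// addr_ge0// ltW.
  by rewrite LM ge0_ler_powR ?nnegrE ?invr_ge0 ?powR_ge0// ltW.
have mlp : measurable_fun [set: T] (fun w => lp_norm p (fun i => X i w)).
  apply: (@measurableT_comp _ _ _ _ _ _ (fun x => x `^ p^-1)) => //.
  by apply: measurable_sum => i; exact: measurable_norm_powR.
have [L_gt0|L_le0] := ltP 0 L; last first.
  have LE : L = 0 by apply/eqP; rewrite eq_le L_le0.
  (* [K / L = K / 0] is [0], so the right-hand side vanishes. *)
  have p1 : p - 1 != 0 by rewrite subr_eq0 gt_eqF//; lra.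
  rewrite LE invr0 !mulr0 powR0// mulr0 mul0r.
  rewrite psi_norm_eq0//; first exact: measurable_funB.
  under eq_integral do
    rewrite subr0 ger0_norm ?powR_ge0// lp_norm_powR// -sumEFin.
  rewrite ge0_integral_sum//; last first.
    by move=> i; apply/measurable_EFinP; exact: measurable_norm_powR.
  by rewrite big1// => i _; rewrite XM -LpM LE powR0 ?gt_eqF.
have K_gt0 : 0 < K by exact: lt_le_trans LK.
set Mr := 6 `^ p^-1 * (4 * A) * (K / L) `^ (p - 1) * K.
(* [K] need not be attained in the infimum defining the psi-norms; any larger
   radius is admissible, and the loss is absorbed by the factor 4. *)
pose k := 2 * K.
have k0 : 0 < k by rewrite /k; lra.
have Kk : K < k by rewrite /k; lra.
have KL1 : 1 <= K / L by rewrite ler_pdivlMr ?mul1r.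
have KLp : K / L <= (K / L) `^ (p - 1) by apply: le1r_powR => //; lra.
have six : 1 <= 6 `^ p^-1 :> R.
  have h6 : 1 <= 6 :> R by lra.
  have pV0 : 0 <= p^-1 by rewrite invr_ge0 ltW.
  by have := ler_powR h6 pV0; rewrite powRr0.
have AMr : A * (k / L) * k <= Mr.
  have -> : A * (k / L) * k = 1 * (4 * A) * (K / L) * K.
    by rewrite /k; field; rewrite gt_eqF.
  rewrite /Mr ler_wpM2r// ler_pM//; [lra|lra|].
  by rewrite ler_wpM2r//; lra.
have Mr0 : 0 < Mr.
  apply: lt_le_trans AMr; rewrite mulr_gt0// mulr_gt0// ?divr_gt0//; lra.
apply: psi_norm_le => //.
pose phi x := `|x / k| `^ p.
have mphi : measurable_fun [set: R] phi.
  by apply: measurable_norm_powR; exact: measurable_funM.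
have phi0 x : 0 <= phi x by exact: powR_ge0.
have phiM i : (\int[P]_w (phi (X i w))%:E = (M / k `^ p)%:E)%E.
  exact: integral_powR_normV.
pose G w := `|\sum_i (phi (X i w) - M / k `^ p)|.
have dev : (\int[P]_w (expR (c / 8 * Num.min (G w ^+ 2 / n.+1%:R) (G w)))%:E <=
    (2 * expR (c / 4) / (1 - expR (- (c / 4))))%:E)%E.
  exact: exp_deviation_le (ltn0Sn n) indX mphi phi0 (fun i => e2 k i Kk) phiM.
have mG : measurable_fun [set: T] G.
  apply: measurableT_comp => //; apply: measurable_sum => i.
  apply: measurable_funB => //; exact: measurableT_comp.
(* Summing the rescaled centred powers recovers [(Z ^ p - mu ^ p) / k ^ p], because [M = L ^ p]. *)
have GE w : G w =
    `|lp_norm p (fun i => X i w) `^ p - n.+1%:R * L `^ p| / k `^ p.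
  rewrite /G big_split/= sumr_const card_ord.
  rewrite lp_norm_powR// LpM -[in RHS](gtr0_norm (powR_gt0 p k0)).
  rewrite -normrV ?unitfE ?gt_eqF ?powR_gt0//.
  rewrite -normrM; congr (`|_|).
  rewrite mulrBl mulr_suml; congr (_ + _); last first.
    by rewrite mulNrn -(mulr_natl (M / _)) mulrA.
  by apply: eq_bigr => i _; rewrite /phi powR_normV// mulrC.
pose V w := c / 8 * Num.min (G w ^+ 2 / n.+1%:R) (G w).
have mV : measurable_fun [set: T] V.
  apply: measurable_funM => //; apply: measurable_minr => //.
  by apply: measurable_funM => //; exact: measurable_funX.
have devB : (\int[P]_w (expR (V w / B))%:E <= 2%:E)%E.
  apply: integral_expR_div_le2 => //.
  by apply: (le_trans dev); rewrite lee_fin lerDr.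
apply: le_trans devB; apply: ge0_le_integral => //.
- apply/measurable_EFinP/measurable_expR_powR; apply: measurable_funM => //.
  exact: measurable_funB.
- by apply/measurable_EFinP/measurableT_comp => //; exact: measurable_funM.
move=> w _; rewrite lee_fin ler_expR.
apply: (@le_trans _ _ (A^-1 * Num.min (G w ^+ 2 / n.+1%:R) (G w))).
  rewrite GE; apply: deviation_rate_le => //; first lra.
  exact: powR_ge0.
rewrite /V [leRHS]mulrAC ler_wpM2r//.
  by rewrite le_min divr_ge0 ?sqr_ge0//= normr_ge0.
rewrite /A invfM invf_div; lra.
Qed.
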